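(* Fix $d\in\mathbb{N}$ (with $d\ge 1$) and let $(\mathcal{W}_i)_{i\in S}$ be the family of random walks (branches) generated by a branching random walk on $\mathbb{Z}^d$ with a nontrivial offspring distribution. Then, almost surely, for every spanning subgraph $G\subset\mathbb{Z}^d$, there is some $j\in S$ for which the induced walk $(\mathcal{W}_j)_G$ is recurrent.
   Context: $\mathbb{Z}^d$ denotes the $d$-dimensional integer lattice, regarded as a graph with vertex set $\mathbb{Z}^d$ and edges between points at Euclidean distance $1$. A spanning subgraph $G\subset\mathbb{Z}^d$ has vertex set all of $\mathbb{Z}^d$ and an arbitrary subset of the edges of the lattice. Branching random walk: a branching random walk on $\mathbb{Z}^d$ starts with a single particle at the origin. At each time step, each particle independently generates a number of additional particles (its children at that step) at its current location according to some fixed offspring distribution on the nonnegative integers; the original particle also remains. Then, independently of the other particles and their history, each particle (old and new) takes a step in a direction chosen uniformly at random from the $2d$ directions $\pm e_1,\dots,\pm e_d$, where $e_1,\dots,e_d$ are the standard unit vectors. The offspring distribution is nontrivial if the number of offspring is nonzero with positive probability. Branches: the walks $\mathcal{W}_i$, $i\in S$, are the branches of the branching random walk: each corresponds to a walk obtained by starting with the original particle at the origin and then, at each time step, following either the particle presently under consideration or one of the children it generates at that time step. Each branch $\mathcal{W}_i$ is viewed as the infinite word on the alphabet $\{\pm e_1,\dots,\pm e_d\}$ recording the successive directions of the steps taken by the particles followed. The (random) index set $S$ is the set of all such infinite branches. Induced walk: given an infinite word $\mathcal{W}=w_1w_2w_3\cdots$ on the alphabet $\{\pm e_1,\dots,\pm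 e_d\}$ and a spanning subgraph $G\subset\mathbb{Z}^d$, the induced walk $\mathcal{W}_G$ on $G$ starts at the origin, and reads the letters of $\mathcal{W}$ one at a time: if the walk is at $v$ and the next letter is $w$, then it moves to $v+w$ if the edge $\{v,v+w\}$ is present in $G$, and stands still at $v$ otherwise. A walk on a graph $G$ is recurrent if it visits every site in the connected component of its starting point in $G$ infinitely often. *)

(* Defs.v *)
From mathcomp Require Import all_boot all_order all_algebra.
From mathcomp Require Import all_classical all_reals all_analysis.
Set Implicit Arguments.
Unset Strict Implicit.
Unset Printing Implicit Defensive.
Import Order.TTheory GRing.Theory Num.Theory.
Local Open Scope classical_set_scope.
Local Open Scope ring_scope.

Definition site (dim : nat) := 'rV[int]_dim.

(* Coordinates are integers, so Euclidean distance 1 is tested on its square. *)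
Definition lattice_edge (dim : nat) (x y : site dim) : bool :=
  \sum_(i < dim) (x 0 i - y 0 i) ^+ 2 == 1.

(* G x y means that the unordered edge {x, y} is present. *)
Definition spanning_subgraph (dim : nat) (G : rel (site dim)) : Prop :=
  symmetric G /\ subrel G (@lattice_edge dim).

Definition connected_in (dim : nat) (G : rel (site dim)) (x y : site dim)
    : Prop :=
  exists2 p : seq (site dim), path G x p & last x p = y.

Definition recurrent (dim : nat) (G : rel (site dim)) (f : nat -> site dim)
    : Prop :=
  forall x, connected_in G (f 0%N) x -> infinite_set [set n | f n = x].

(* (i, true) is the letter e_i and (i, false) the letter - e_i. *)
Definition direction (dim : nat) : Type := ('I_dim * bool)%type.

Definition dir_vec (dim : nat) (w : direction dim) : site dim :=
  if w.2 then delta_mx 0 w.1 else - delta_mx 0 w.1.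

(* The word w_1 w_2 w_3 ... is the function n |-> w_(n+1). *)
Fixpoint induced_walk (dim : nat) (G : rel (site dim))
    (W : nat -> direction dim) (n : nat) : site dim :=
  if n is m.+1 then
    let v := induced_walk G W m in
    let v' := v + dir_vec (W m) in
    if G v v' then v' else v
  else 0.

(* Independence of a family of set systems (the product rule over every finite
   subfamily); for random variables, F i is the sigma-algebra of the i-th. *)
Definition mutually_independent (R : realType) (d : measure_display)
    (T : measurableType d) (P : probability T R) (I : eqType)
    (F : I -> set_system T) : Prop :=
  forall (J : seq I) (A : I -> set T),
    uniq J -> (forall i, i \in J -> F i (A i)) ->
    P (\bigcap_(i in [set` J]) A i) = (\prod_(i <- J) P (A i))%E.

(* Particles are followed in time: a label u = [:: u_0; ...; u_(n-1)] denotes a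
   particle present at time n, the original particle at time 0 being [::].
   During the next time step, u generates [xi u] children; the particle itself
   (k = 0) and its children (1 <= k <= xi u) then make the steps [X u k] and
   carry at time n+1 the labels [rcons u k].
   As in the usual Ulam-Harris construction, xi and X are defined for all
   labels, including those that are not realised. *)
Definition offspring_family (T : Type) : Type := seq nat -> T -> nat.
Definition step_family (dim : nat) (T : Type) : Type :=
  seq nat -> nat -> T -> direction dim.

Definition brw_sigma (dim : nat) (T : Type) (xi : offspring_family T)
    (X : step_family dim T) (i : seq nat + (seq nat * nat)) : set_system T :=
  match i with
  | inl u => preimage_set_system setT (xi u) setT
  | inr (u, k) => preimage_set_system setT (X u k) setT
  end.

Record branching_random_walk (R : realType) (dim : nat) (d : measure_display)
    (T : measurableType d) (P : probability T R) (mu : probability nat R)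
    (xi : offspring_family T) (X : step_family dim T) : Prop := {
  brw_measurable_offspring :
    forall u (B : set nat), measurable (xi u @^-1` B);
  brw_measurable_step :
    forall u k (B : set (direction dim)), measurable (X u k @^-1` B);
  brw_offspring_law :
    forall u (B : set nat), P (xi u @^-1` B) = mu B;
  brw_step_uniform :
    forall u k (w : direction dim),
      P (X u k @^-1` [set w]) = ((2 * dim)%:R^-1)%:E;
  brw_independent : mutually_independent P (brw_sigma xi X)
}.

Definition nontrivial_offspring (R : realType) (mu : probability nat R)
    : Prop :=
  (0 < mu [set k | k != 0%N])%E.

(* The n-th choice of b is 0 for staying with the present particle and k >= 1
   for moving to its k-th child; the particle followed at time n thus has
   label b_0 ... b_(n-1). *)
Definition label_at (b : nat -> nat) (n : nat) : seq nat := mkseq b n.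

Definition branches (T : Type) (xi : offspring_family T) (omega : T)
    : set (nat -> nat) :=
  [set b | forall n, (b n <= xi (label_at b n) omega)%N].

Definition branch_word (dim : nat) (T : Type) (X : step_family dim T)
    (omega : T) (b : nat -> nat) : nat -> direction dim :=
  fun n => X (label_at b n) (b n) omega.

(* Main.v *)
Require Import Defs.
From mathcomp Require Import all_boot all_order all_algebra.
From mathcomp Require Import all_classical all_reals all_analysis.
From mathcomp Require Import ring lra zify.
Set Implicit Arguments.
Unset Strict Implicit.
Unset Printing Implicit Defensive.
Import Order.TTheory GRing.Theory Num.Theory.
Local Open Scope classical_set_scope.
Local Open Scope ring_scope.

(* It suffices that almost surely, for every realised particle, every G and
   every site y of the component of that particle, some descendant reaches y:
   a recurrent branch is then obtained by concatenating such finite pieces, and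
   only countably many particles are involved.

   For fixed G the probability g_n(x) that y is hit within n steps from x
   satisfies g_(n+1) >= h(A g_n), where A averages over one step of the walk on
   G, h(z) = z + p z (1 - z), and p is the probability of having a child. As A
   is symmetric, A^(2l)(x, x) >= 1/|V| on a box V, so a value eps of g at x is at
   least doubled after 2l steps if (1 + p/2)^(2l) >= 2|V|, as long as eps is at
   most of order (1 + p/2)^(-2l). Starting from g_r(x) >= (2 dim)^(-r) at distance
   r, this gives a lower bound for g_n(x), with n quadratic in l for r linear
   in l.

   All G are treated at once by a union bound: at time 5l there are, up to a
   small probability, at least about (1 + p/2)^(3l) particles, whose failures are
   independent. This number beats the logarithm of the number of subgraphs of a
   box whose side is polynomial in l, even after the loss of (1 + p/2)^(2l). *)

(** * Binary trees with independent labels *)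

Section Trees.
Variables (R : realType) (D V : finType) (p : R).

(** The trees are full: the second subtree is recorded even when the boolean denies the second
    child. All labels are then independent, and [tree_wt] is a product law on a finite type. *)
Fixpoint tree (n : nat) : finType :=
  if n is m.+1 then (bool * ((D * tree m) * (D * tree m)))%type else unit.

Fixpoint tree_wt (n : nat) : tree n -> R :=
  if n is m.+1 then fun c : tree m.+1 =>
    (if c.1 then p else 1 - p) *
    ((#|D|%:R^-1 * tree_wt c.2.1.2) * (#|D|%:R^-1 * tree_wt c.2.2.2))
  else fun=> 1.

Variable a : V -> D -> V.

Definition avg (f : V -> R) (x : V) : R := #|D|%:R^-1 * \sum_w f (a x w).

(* The product over the vertices, each contributing b (height) (position),
   where the particle moves on V through a; the second child of a vertex counts
   only if the boolean of that vertex is set. *)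
Fixpoint tree_prod (b : nat -> V -> R) (n : nat) (x : V) : tree n -> R :=
  if n is m.+1 then fun c : tree m.+1 =>
    b m.+1 x * (tree_prod b (a x c.2.1.1) c.2.1.2 *
      (if c.1 then tree_prod b (a x c.2.2.1) c.2.2.2 else 1))
  else fun=> b 0%N x.

(** The expectation of [tree_prod] under [tree_wt]: the two subtrees are independent, and (1 - p) z
    + p z^2 is the generating function of the number of particles after one split. *)
Fixpoint mean_prod (b : nat -> V -> R) (n : nat) (x : V) : R :=
  if n is m.+1 then
    let z := avg (mean_prod b m) x in b m.+1 x * ((1 - p) * z + p * z ^+ 2)
  else b 0%N x.

Hypothesis D_gt0 : (0 < #|D|)%N.

Lemma sum_tree n (F : tree n.+1 -> R) :
  \sum_(c : tree n.+1) F c =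
  \sum_(e : bool) \sum_(wc : D * tree n) \sum_(wc' : D * tree n)
    F (e, (wc, wc')).
Proof.
rewrite (eq_bigr (fun c : tree n.+1 => F (c.1, c.2))); last by case.
rewrite -(pair_bigA _ (fun e wc => F (e, wc))) /=.
apply: eq_bigr => e _.
rewrite (eq_bigr (fun c => F (e, (c.1, c.2)))); last by move=> [].
by rewrite -(pair_bigA _ (fun wc wc' => F (e, (wc, wc')))).
Qed.

Lemma sum_branch n (F : D -> tree n -> R) :
  \sum_(wc : D * tree n) (#|D|%:R^-1 * tree_wt wc.2) * F wc.1 wc.2 =
  #|D|%:R^-1 * \sum_w \sum_c tree_wt c * F w c.
Proof.
rewrite -(pair_bigA _ (fun w c => (#|D|%:R^-1 * tree_wt c) * F w c)) /=.
rewrite mulr_sumr; apply: eq_bigr => w _; rewrite mulr_sumr.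
by apply: eq_bigr => c _; rewrite mulrA.
Qed.

Lemma tree_wt_ge0 n (c : tree n) : 0 <= p <= 1 -> 0 <= tree_wt c.
Proof.
move=> /andP[p0 p1]; elim: n c => [//|n IH] [e [[w c] [w' c']]] /=.
rewrite mulr_ge0//; first by case: e; rewrite ?subr_ge0.
by rewrite !mulr_ge0 ?invr_ge0 ?IH.
Qed.

Lemma sum_branch_wt n :
  \sum_(c : tree n) tree_wt c = 1 ->
  \sum_(wc : D * tree n) (#|D|%:R^-1 * tree_wt wc.2) = 1.
Proof.
move=> IH; have := sum_branch (fun (_ : D) (_ : tree n) => 1).
under eq_bigr do rewrite mulr1.
move=> ->; under eq_bigr do under eq_bigr do rewrite mulr1.
rewrite IH sumr_const -[1 *+ _]/(_%:R) mulVf//.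
by rewrite pnatr_eq0 -lt0n.
Qed.

Lemma sum_tree_wt n : \sum_(c : tree n) tree_wt c = 1.
Proof.
elim: n => [|n IH]; first by rewrite (big_pred1 tt) // => -[].
have E := sum_branch_wt IH; rewrite sum_tree big_bool /=.
do 2![under eq_bigr do rewrite -mulr_sumr -mulr_sumr E mulr1;
  rewrite -mulr_sumr E mulr1].
by rewrite addrC subrK.
Qed.

Lemma mean_prodE b n x :
  \sum_(c : tree n) tree_wt c * tree_prod b x c = mean_prod b n x.
Proof.
elim: n x => [|n IH] x /=; first by rewrite (big_pred1 tt) ?mul1r// => -[].
have E : \sum_(wc : D * tree n) (#|D|%:R^-1 * tree_wt wc.2) *
    tree_prod b (a x wc.1) wc.2 = avg (mean_prod b n) x.
  rewrite (sum_branch (fun w c => tree_prod b (a x w) c)) /avg.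
  by congr (_ * _); apply: eq_bigr => w _; rewrite IH.
have E1 := sum_branch_wt (sum_tree_wt n).
rewrite sum_tree big_bool /=.
set z := avg _ _ in E *.
transitivity (b n.+1 x * (p * (z * z)) + b n.+1 x * ((1 - p) * (z * 1))); last first.
  by rewrite mulr1 expr2; ring.
congr (_ + _).
  rewrite -E big_distrlr /= !mulr_sumr; apply: eq_bigr => wc _.
  by rewrite !mulr_sumr; apply: eq_bigr => wc' _; ring.
have -> : z * 1 = z * \sum_(wc : D * tree n) (#|D|%:R^-1 * tree_wt wc.2).
  by rewrite E1.
rewrite -E big_distrlr /= !mulr_sumr; apply: eq_bigr => wc _.
by rewrite !mulr_sumr; apply: eq_bigr => wc' _; ring.
Qed.

Lemma ler_avg f g : (forall x, f x <= g x) -> forall x, avg f x <= avg g x.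
Proof. by move=> fg x; rewrite ler_wpM2l ?invr_ge0// ler_sum. Qed.

Lemma avg_cst r x : avg (fun=> r) x = r.
Proof.
rewrite /avg sumr_const -[r *+ _]mulr_natl mulrA mulVf ?mul1r//.
by rewrite pnatr_eq0 -lt0n.
Qed.

Lemma avgZ r f x : avg (fun z => r * f z) x = r * avg f x.
Proof. by rewrite /avg -mulr_sumr mulrCA. Qed.

Lemma avgB f x : avg (fun z => 1 - f z) x = 1 - avg f x.
Proof.
by rewrite -[X in _ = X - _](avg_cst 1 x) /avg -mulrBr -sumrB.
Qed.

(** The transition matrix of the uniform letter walk is symmetric, which makes [avg] self-adjoint
    for the counting measure. *)
Definition symmetric_act : bool :=
  [forall x, forall z, #|[pred w | a x w == z]| == #|[pred w | a z w == x]|].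

Lemma avg_card f x :
  avg f x = #|D|%:R^-1 * \sum_z #|[pred w | a x w == z]|%:R * f z.
Proof.
congr (_ * _); rewrite (partition_big (a x) xpredT)//=.
apply: eq_bigr => z _; rewrite (eq_bigr (fun=> f z)); last by move=> w /eqP ->.
by rewrite sumr_const mulr_natl.
Qed.

Lemma avg_selfadjoint f g : symmetric_act ->
  \sum_x f x * avg g x = \sum_x avg f x * g x.
Proof.
move=> /forallP sa; under eq_bigr do rewrite avg_card mulrCA.
under [RHS]eq_bigr do rewrite avg_card -mulrA.
rewrite -!mulr_sumr; congr (_ * _).
under eq_bigr do rewrite mulr_sumr.
under [RHS]eq_bigr do rewrite mulr_suml.
rewrite exchange_big /=; apply: eq_bigr => x _; apply: eq_bigr => z _.
by rewrite (eqP (forallP (sa x) z)); ring.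
Qed.

Lemma iter_avg_selfadjoint l f g : symmetric_act ->
  \sum_x f x * iter l avg g x = \sum_x iter l avg f x * g x.
Proof.
move=> sa; elim: l f => [//|l IH] f.
by rewrite iterS avg_selfadjoint// IH -iterSr.
Qed.

(* Cauchy-Schwarz, after splitting the return at the midpoint. *)
Lemma return_ge l (x : V) : symmetric_act ->
  #|V|%:R^-1 <= iter (l + l) avg (fun z => (z == x)%:R) x.
Proof.
move=> sa; set q := iter l avg (fun z => (z == x)%:R).
have pick (f : V -> R) : \sum_z (z == x)%:R * f z = f x.
  rewrite (bigD1 x)//= eqxx mul1r big1 ?addr0// => z /negbTE ->.
  by rewrite mul0r.
have sumq : \sum_z q z = 1.
  under eq_bigr do rewrite -[q _]mul1r.
  rewrite (iter_avg_selfadjoint _ (fun=> 1))//.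
  under eq_bigr do rewrite mulrC.
  rewrite pick; elim: l {q} => [//|l IH]; rewrite iterS.
  have {}IH z : iter l avg (fun=> 1) z = 1.
    elim: l z {IH} => [//|l IH] z; rewrite iterS -[RHS](avg_cst 1 z).
    by congr (_ * _); apply: eq_bigr => w _.
  by rewrite -[RHS](avg_cst 1 x); congr (_ * _); apply: eq_bigr => w _.
have -> : iter (l + l) avg (fun z => (z == x)%:R) x = \sum_z q z ^+ 2.
  rewrite -[LHS](pick (iter (l + l) avg (fun z => (z == x)%:R))).
  under eq_bigr do rewrite iterD.
  by rewrite iter_avg_selfadjoint//; apply: eq_bigr => z _; rewrite expr2.
have V0 : #|V|%:R != 0 :> R.
  by rewrite pnatr_eq0 -lt0n; apply/card_gt0P; exists x.
(* Cauchy-Schwarz, as the nonnegativity of a variance. *)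
have : 0 <= \sum_z (q z - #|V|%:R^-1) ^+ 2 by apply: sumr_ge0 => z _; exact: sqr_ge0.
rewrite (eq_bigr (fun z =>
  q z ^+ 2 - (2 * #|V|%:R^-1) * q z + #|V|%:R^-1 ^+ 2)); last first.
  by move=> z _; ring.
rewrite big_split sumrB -mulr_sumr sumq sumr_const -[_ ^+ 2 *+ _]mulr_natl /=.
rewrite expr2 mulrA divff// mul1r mulr1.
by move: (\sum_z _) => S; lra.
Qed.

End Trees.

(** * Growth of the hitting probability *)

Section Growth.
Variables (R : realType) (D V : finType) (p : R) (a : V -> D -> V).
Hypotheses (D_gt0 : (0 < #|D|)%N) (p_gt0 : 0 < p) (p_le1 : p <= 1).

Lemma mean_prod_ge0 (b : nat -> V -> R) n x :
  (forall m z, 0 <= b m z) -> 0 <= mean_prod p a b n x.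
Proof.
move=> b0; elim: n x => [|n IH] x //=.
have A0 : 0 <= avg a (mean_prod p a b n) x.
  by rewrite mulr_ge0 ?invr_ge0// sumr_ge0.
apply: mulr_ge0 => //; apply: addr_ge0; apply: mulr_ge0 => //.
- by rewrite subr_ge0.
- exact: ltW.
- exact: exprn_ge0.
Qed.

Lemma eq_mean_prod (b b' : nat -> V -> R) n x :
  (forall m z, (m <= n)%N -> b m z = b' m z) ->
  mean_prod p a b n x = mean_prod p a b' n x.
Proof.
elim: n x => [|n IH] x bb' /=; first by rewrite bb'.
rewrite bb'//;
suff -> : avg a (mean_prod p a b n) x = avg a (mean_prod p a b' n) x by [].
by congr (_ * _); apply: eq_bigr => w _; apply: IH => m z mn; rewrite bb'// leqW.
Qed.

(** The probability that at least one particle succeeds after a split, if each does so independently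
    with probability z: with w = 1 - z, one has 1 - [grow z] = (1 - p) w + p w^2. *)
Definition grow (z : R) : R := z + p * z * (1 - z).

Lemma grow_le1 z : 0 <= z <= 1 -> grow z <= 1.
Proof.
move=> /andP[z0 z1]; rewrite -subr_ge0 /grow.
rewrite (_ : 1 - _ = (1 - z) * (1 - p * z)); last by ring.
by rewrite mulr_ge0// subr_ge0 ?mulr_ile1// ltW.
Qed.

Lemma le_grow z : 0 <= z <= 1 -> z <= grow z.
Proof.
by move=> /andP[z0 z1]; rewrite /grow lerDl !mulr_ge0 ?subr_ge0// ltW.
Qed.

(** [grow] is increasing on [0, 1], and at u <= 1/2 its factor 1 + p (1 - u) is at least 1 + p/2. *)
Lemma grow_ge u z : 0 <= u -> u <= z -> z <= 1 -> u <= 2^-1 ->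
  (1 + p / 2) * u <= grow z.
Proof.
move=> u0 uz z1 u2; have : grow u <= grow z.
  rewrite -subr_ge0 /grow.
  rewrite (_ : _ - _ = (z - u) * (1 + p * (1 - z - u))); last by ring.
  rewrite mulr_ge0 ?subr_ge0// mulrBr.
  have : 0 <= p * (1 - z) by rewrite mulr_ge0 ?subr_ge0// ltW.
  have : p * u <= 1 by rewrite mulr_ile1// ?(le_trans u2)// ?ltW//; lra.
  by lra.
apply: le_trans; rewrite -subr_ge0 /grow.
rewrite (_ : _ - _ = p * u * (2^-1 - u)); last by field.
by rewrite !mulr_ge0 ?subr_ge0// ltW.
Qed.

Definition hit_pr (y : V) n x : R :=
  1 - mean_prod p a (fun _ z => (z != y)%:R) n x.

Lemma hit_prS y n x :
  hit_pr y n.+1 x = if x == y then 1 else grow (avg a (hit_pr y n) x).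
Proof.
rewrite /hit_pr /=; case: (x == y) => /=; first by rewrite mul0r subr0.
by rewrite mul1r avgB// /grow; ring.
Qed.

Lemma hit_pr_itv y n x : 0 <= hit_pr y n x <= 1.
Proof.
elim: n x => [|n IH] x.
  by rewrite /hit_pr /=; case: (x == y); rewrite ?subr0 ?subrr ?lexx ?ler01.
rewrite hit_prS; case: ifP => _; first by rewrite ler01 lexx.
have A : 0 <= avg a (hit_pr y n) x <= 1.
  rewrite -[X in _ <= _ <= X](avg_cst a D_gt0 1 x) ler_avg ?andbT; last first.
    by move=> z; case/andP: (IH z).
  rewrite -(avg_cst a D_gt0 0 x) ler_avg// => z; by case/andP: (IH z).
by rewrite grow_le1// andbT (le_trans _ (le_grow A))//; case/andP: A.
Qed.

Lemma avg_hit_pr_itv y n x : 0 <= avg a (hit_pr y n) x <= 1.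
Proof.
apply/andP; split.
  rewrite -(avg_cst a D_gt0 0 x) ler_avg// => z.
  by case/andP: (hit_pr_itv y n z).
rewrite -[X in _ <= X](avg_cst a D_gt0 1 x) ler_avg// => z.
by case/andP: (hit_pr_itv y n z).
Qed.

Fixpoint reach_within (y : V) (r : nat) (x : V) : bool :=
  (x == y) || (if r is s.+1 then [exists w, reach_within y s (a x w)] else false).

Lemma reach_within_step y r x w : symmetric_act a -> reach_within y r x ->
  reach_within y r.+1 (a x w).
Proof.
move=> /forallP sa wx; apply/orP; right; apply/existsP.
have /eqP E := forallP (sa x) (a x w).
have : (0 < #|[pred w' | a (a x w) w' == x]|)%N.
  by rewrite -E; apply/card_gt0P; exists w; rewrite inE.
by case/card_gt0P => w'; rewrite inE => /eqP E'; exists w'; rewrite E'.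
Qed.

(** The original particle alone follows a shortest route with probability 1/|D| per step; [le_grow]
    says that further children only help. *)
Lemma hit_pr_within y r x : reach_within y r x -> #|D|%:R^-1 ^+ r <= hit_pr y r x.
Proof.
have D1 : (#|D|%:R : R)^-1 <= 1 by rewrite invf_le1 ?ltr0n// ler1n.
elim: r x => [|r IH] x /=; first by rewrite orbF /hit_pr /= => ->; rewrite subr0.
rewrite hit_prS; case: eqP => [_ _|_ /= /existsP[w wi]].
  by rewrite exprn_ile1// invr_ge0.
apply: le_trans (le_grow (avg_hit_pr_itv _ _ _)).
rewrite exprS ler_wpM2l ?invr_ge0// (le_trans (IH _ wi))//.
rewrite (bigD1 w)//= lerDl sumr_ge0// => z _.
by case/andP: (hit_pr_itv y r (a x z)).
Qed.

(* Below the level 1/2, [grow] dominates multiplication by 1 + p/2, so g dominates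
   a multiple of the powers of A applied to the indicator of x. *)
Lemma hit_pr_double y l n x (eps : R) : symmetric_act a -> 0 <= eps ->
  eps * (1 + p / 2) ^+ (l + l) <= 2^-1 -> eps <= hit_pr y n x ->
  eps * (1 + p / 2) ^+ (l + l) / #|V|%:R <= hit_pr y (n + (l + l)) x.
Proof.
move=> sa e0 e2 ex.
have iter_ge0 i z : 0 <= iter i (avg a) (fun z => (z == x)%:R) z :> R.
  elim: i z => [|i IH] z; first by rewrite /= ler0n.
  by rewrite iterS mulr_ge0 ?invr_ge0// sumr_ge0.
have iter_le1 i z : iter i (avg a) (fun z => (z == x)%:R) z <= 1 :> R.
  elim: i z => [|i IH] z; first by rewrite /= lern1 leq_b1.
  by rewrite iterS -[X in _ <= X](avg_cst a D_gt0 1 z) ler_avg.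
have b0 : 0 <= 1 + p / 2 by rewrite addr_ge0// divr_ge0// ltW.
suff H i z : (i <= l + l)%N ->
    (eps * (1 + p / 2) ^+ i) * iter i (avg a) (fun z => (z == x)%:R) z
      <= hit_pr y (n + i) z.
  apply: le_trans (H _ x (leqnn _)).
  by rewrite ler_wpM2l ?return_ge// mulr_ge0// exprn_ge0.
elim: i z => [|i IH] z il.
  rewrite addn0 mulr1 /=; case: eqP => [->|_]; first by rewrite mulr1.
  by rewrite mulr0; case/andP: (hit_pr_itv y n z).
rewrite addnS hit_prS; set c := eps * _ ^+ i in IH.
have c0 : 0 <= c by rewrite mulr_ge0// exprn_ge0.
have c2 : c <= 2^-1.
  apply: le_trans e2; rewrite ler_wpM2l// ler_weXn2l//; last exact: ltnW.
  by rewrite lerDl divr_ge0// ltW.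
have -> : eps * (1 + p / 2) ^+ i.+1 = (1 + p / 2) * c by rewrite exprS mulrCA.
rewrite -[_ * c * _]mulrA iterS -avgZ.
set u := avg a _ z.
have u0 : 0 <= u by rewrite mulr_ge0 ?invr_ge0// sumr_ge0// => w _; rewrite mulr_ge0.
have u2 : u <= 2^-1.
  apply: le_trans c2; rewrite -(avg_cst a D_gt0 c z); apply: ler_avg => z'.
  by rewrite -[X in _ <= X]mulr1 ler_wpM2l.
case: ifP => _.
  (* At y the hitting probability is 1, which is [grow 1], so [grow_ge] serves here too. *)
  apply: (@le_trans _ _ (grow 1)); last by rewrite /grow subrr mulr0 addr0.
  by rewrite grow_ge//; lra.
apply: grow_ge => //; last by case/andP: (avg_hit_pr_itv y (n + i) z).
by apply: ler_avg => z'; apply: IH; exact: ltnW.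
Qed.

(** Each round of 2l steps doubles the bound until it reaches [del], the level at which [del * B] is
    1/2 and [hit_pr_double] stops applying. As 2^|D| >= |D|, r |D| rounds make up for the initial
    value |D|^(-r). *)
Lemma hit_pr_ge y l r x :
  symmetric_act a -> 2 * #|V|%:R <= (1 + p / 2) ^+ (l + l) -> reach_within y r x ->
  (2 * (1 + p / 2) ^+ (l + l))^-1 <= hit_pr y (r + (r * #|D|) * (l + l)) x.
Proof.
move=> sa; set B := _ ^+ (l + l) => VB wx; set del := (2 * B)^-1.
have V0 : 0 < #|V|%:R :> R by rewrite ltr0n; apply/card_gt0P; exists x.
have B0 : 0 < B by lra.
have del0 : 0 < del by rewrite invr_gt0 mulr_gt0.
have D0 : 0 < #|D|%:R :> R by rewrite ltr0n.
suff H j : Num.min del (2 ^+ j * #|D|%:R^-1 ^+ r) <= hit_pr y (r + j * (l + l)) x.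
  apply: le_trans (H _); rewrite le_min lexx /=.
  have del1 : del <= 1.
    rewrite invf_le1 ?mulr_gt0//.
    have : 1 <= #|V|%:R :> R by rewrite ler1n; apply/card_gt0P; exists x.
    by lra.
  apply: (le_trans del1); rewrite mulnC exprM -exprMn exprn_ege1//.
  rewrite ler_pdivlMr// mul1r.
  by rewrite -natrX ler_nat ltnW// ltn_expl.
elim: j => [|j IH].
  by rewrite addn0 mul1r ge_min hit_pr_within// orbT.
rewrite mulSn [(l + l + _)%N]addnC addnA.
set m := Num.min del (2 ^+ j * _) in IH.
have m0 : 0 <= m.
  by rewrite le_min ltW//= mulr_ge0// exprn_ge0// invr_ge0.
have mdel : m <= del by rewrite ge_min lexx.
have dB : del * B = 2^-1 by rewrite /del invfM mulfVK// gt_eqF.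
have mB : m * B <= 2^-1 by rewrite -dB ler_wpM2r// ltW.
apply: le_trans (hit_pr_double sa m0 mB IH); rewrite -/B.
rewrite ler_pdivlMr//.
apply: (@le_trans _ _ (m * 2 * #|V|%:R)); last by rewrite -mulrA ler_wpM2l.
rewrite ler_wpM2r// ge_min; apply/orP.
rewrite /m; case: (leP del (2 ^+ j * _)) => _; first by left; lra.
by right; rewrite exprS -mulrA mulrC.
Qed.

End Growth.

(** * The union bound *)

Section UnionBound.
Variables (R : realType) (D V : finType) (p : R).
Hypotheses (D_gt0 : (0 < #|D|)%N) (p_gt0 : 0 < p) (p_le1 : p <= 1).

Fixpoint misses (a : V -> D -> V) (y : V) (n : nat) (x : V) :
    tree D n -> bool :=
  if n is m.+1 then fun c : tree D m.+1 =>
    [&& x != y, misses a y (a x c.2.1.1) c.2.1.2 &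
      c.1 ==> misses a y (a x c.2.2.1) c.2.2.2]
  else fun=> x != y.

(* Levels are counted from the leaves: the number of vertices of remaining
   height n0. *)
Fixpoint level_size (n0 n : nat) : tree D n -> nat :=
  if n is m.+1 then fun c : tree D m.+1 =>
    ((m.+1 == n0) + (level_size n0 c.2.1.2 +
      (if c.1 then level_size n0 c.2.2.2 else 0)))%N
  else fun=> (0 == n0)%N.

Definition miss_weight (y : V) (n0 : nat) (lam : R) (m : nat) (x : V) : R :=
  (x != y)%:R * lam ^+ (m == n0).

Lemma tree_prod_miss a y (n0 : nat) (lam : R) n x (c : tree D n) :
  tree_prod a (miss_weight y n0 lam) x c =
  (misses a y x c)%:R * lam ^+ level_size n0 c.
Proof.
elim: n x c => [//|n IH] x [e [[w c] [w' c']]] /=.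
rewrite /miss_weight !IH; case: e => /=; last first.
  by rewrite andbT addn0 mulr1 exprD -mulnb natrM mulrACA.
rewrite !exprD -!mulnb !natrM.
move: (x != y)%:R (misses _ _ _ c)%:R (misses _ _ _ c')%:R
  (lam ^+ _) (lam ^+ _) (lam ^+ _) => A A1 A2 L L1 L2.
ring.
Qed.

Lemma tree_prod_size (a : V -> D -> V) (n0 : nat) (s : R) n x (c : tree D n) :
  tree_prod a (fun m _ => s ^+ (m == n0)) x c = s ^+ level_size n0 c.
Proof.
elim: n x c => [//|n IH] x [e [[w c] [w' c']]] /=.
by rewrite !IH !exprD; case: e; rewrite ?mulr1 ?expr0.
Qed.

(** The generating function of the population at time t is the t-th iterate of that of one split,
    which s -> 1 - s conjugates to [grow]. Subtrees of height below n0 contribute the factor 1. *)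
Lemma mean_prod_size (a : V -> D -> V) (n0 : nat) (s : R) t x :
  mean_prod p a (fun m _ => s ^+ (m == n0)) (n0 + t) x =
  1 - iter t (grow p) (1 - s).
Proof.
have E m z : mean_prod p a (fun m _ => s ^+ (m == n0)) m z =
   if (m < n0)%N then 1 else 1 - iter (m - n0) (grow p) (1 - s).
  elim: m z => [|m IH] z.
    by case: n0 => [|n0] /=; rewrite ?expr1 ?expr0//; ring.
  rewrite /=.
  have -> : avg a (mean_prod p a (fun m0 : nat => fun=> s ^+ (m0 == n0)) m) z
      = if (m < n0)%N then 1 else 1 - iter (m - n0) (grow p) (1 - s).
    by rewrite -[RHS](avg_cst a D_gt0 _ z); congr (_ * _); apply: eq_bigr.
  case: (ltngtP m.+1 n0) => [mn|mn|<-].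
  - by rewrite expr0; ring.
  - by rewrite expr0 subSn// iterS /grow; ring.
  - by rewrite subnn expr1 /=; ring.
by rewrite E ltnNge leq_addr addKn.
Qed.

Lemma iter_grow_itv i (a0 : R) : 0 <= a0 <= 1 -> 0 <= iter i (grow p) a0 <= 1.
Proof.
move=> a01; elim: i => [//|i /= IH]; rewrite grow_le1// andbT.
by rewrite (le_trans _ (le_grow p_gt0 IH))//; case/andP: IH.
Qed.

(** Two phases: 4l steps, each multiplying by at least 1 + p/2, lift a0 to 1/2; from there on 1 - z
    shrinks by the factor 1 - p z <= 1 - p/2 at each of the last l steps. *)
Lemma iter_grow l (a0 : R) : 0 <= a0 <= 1 ->
  2^-1 <= a0 * (1 + p / 2) ^+ (4 * l) ->
  1 - iter (5 * l) (grow p) a0 <= (1 - p / 2) ^+ l.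
Proof.
move=> a01 a0l.
have itv i := iter_grow_itv i a01.
have b0 : 1 <= 1 + p / 2 by rewrite lerDl divr_ge0// ltW.
have H i : Num.min 2^-1 (a0 * (1 + p / 2) ^+ i) <= iter i (grow p) a0.
  elim: i => [|i IH]; first by rewrite mulr1 ge_min lexx orbT.
  have /andP[i0 i1] := itv i.
  set m := Num.min _ _ in IH.
  have m0 : 0 <= m.
    rewrite le_min invr_ge0 ler0n /= mulr_ge0 ?exprn_ge0//; last by lra.
    by case/andP: a01.
  have m2 : m <= 2^-1 by rewrite ge_min lexx.
  apply: le_trans (grow_ge p_gt0 p_le1 m0 IH i1 m2).
  rewrite /m; case: (leP 2^-1 (a0 * (1 + p / 2) ^+ i)) => _; rewrite ge_min;
    apply/orP.
    by left; rewrite ler_peMl.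
  by right; rewrite exprS mulrCA.
have H2 i : 2^-1 <= iter (4 * l + i) (grow p) a0 /\
    1 - iter (4 * l + i) (grow p) a0 <= (1 - p / 2) ^+ i.
  elim: i => [|i [IH1 IH2]].
    rewrite addn0 expr0; split.
      by apply: le_trans (H _); rewrite le_min lexx.
    by rewrite gerBl; case/andP: (itv (4 * l)%N).
  have /andP[i0 i1] := itv (4 * l + i)%N.
  rewrite addnS iterS; move: (iter _ _ _) => z in IH1 IH2 i0 i1 *.
  split; first by rewrite (le_trans IH1)// le_grow// i0.
  rewrite exprS /grow.
  rewrite (_ : 1 - (z + _) = (1 - p * z) * (1 - z)); last by ring.
  apply: ler_pM => //; rewrite ?subr_ge0//.
    by rewrite mulr_ile1// ltW.
  by rewrite lerD2l lerN2 ler_wpM2l// ltW.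
by rewrite (_ : (5 * l = 4 * l + l)%N); [case: (H2 l) | lia].
Qed.

(** At height n the mean is lam times the miss probability, at most 1 by hypothesis. Going up,
    averages and u -> (1 - p) u + p u^2 preserve the bound 1. In t steps the distance to y grows by
    at most t, by symmetry, hence the radius k + t. *)
Lemma mean_prod_miss (a : V -> D -> V) y k t n (lam : R) x :
  symmetric_act a -> 0 <= lam ->
  (forall z, reach_within a y (k + t) z -> lam * (1 - hit_pr p a y n z) <= 1) ->
  reach_within a y k x ->
  mean_prod p a (miss_weight y n lam) (n + t) x <= 1.
Proof.
move=> sa lam0 far.
have w0 m z : 0 <= miss_weight y n lam m z by rewrite mulr_ge0// exprn_ge0.
have E z : mean_prod p a (miss_weight y n lam) n z = lam * (1 - hit_pr p a y n z).
  rewrite /hit_pr opprB addrC subrK.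
  case: n far w0 => [|n] far w0 /=; first by rewrite /miss_weight mulrC.
  rewrite [X in avg a X](_ : _ = mean_prod p a (fun=> fun u => (u != y)%:R) n).
    by rewrite /miss_weight eqxx expr1; ring.
  apply/funext => u; apply: eq_mean_prod => m v mn.
  by rewrite /miss_weight ltn_eqF ?mulr1.
suff H m z : (m <= t)%N -> reach_within a y (k + (t - m)) z ->
    mean_prod p a (miss_weight y n lam) (n + m) z <= 1.
  by move=> wx; apply: H => //; rewrite subnn addn0.
elim: m z => [|m IH] z mt; first by rewrite subn0 addn0 E => /far.
move=> wz; rewrite addnS /=; set u := avg _ _ _.
have u0 : 0 <= u.
  by rewrite mulr_ge0 ?invr_ge0// sumr_ge0// => w _; apply: mean_prod_ge0.
have u1 : u <= 1.
  rewrite -[X in _ <= X](avg_cst a D_gt0 1 z) ler_wpM2l ?invr_ge0// ler_sum// => w _.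
  apply: IH; first exact: ltnW.
  by rewrite (_ : (k + (t - m) = (k + (t - m.+1)).+1)%N) ?reach_within_step//; lia.
rewrite mulr_ile1 ?w0//.
- by rewrite addr_ge0// mulr_ge0 ?exprn_ge0 ?subr_ge0// ltW.
- rewrite /miss_weight (_ : (n + m).+1 == n = false) ?mulr1 ?lern1 ?leq_b1//.
  by apply/negP; lia.
- rewrite expr2 (_ : _ + _ = u * ((1 - p) + p * u)); last by ring.
  move: u u0 u1 => u u0 u1.
  have pu : p * u <= p by rewrite ler_piMr// ltW.
  have pu0 : 0 <= p * u by rewrite mulr_ge0// ltW.
  by rewrite mulr_ile1//; have := p_le1; lra.
Qed.

(* Let N be the population at time 5l. With s = 1 - 1/(2K) < 1 < lam =
   1/(1 - del), the indicator of a miss is at most s^(N-K) + lam^(N-K) 1_miss: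
   the first term handles N <= K, the second one N > K; both have explicit
   recursions for their means. *)
Lemma tree_union_bound k l K x (Q : pred ({ffun V * D -> V} * V)) :
  let B := (1 + p / 2) ^+ l in
  let r := (k + 5 * l)%N in
  let n := (r + r * #|D| * (l + l))%N in
  let del := (2 * B ^+ 2)^-1 in
  (forall ay, Q ay -> symmetric_act (fun z w => ay.1 (z, w)) /\
     reach_within (fun z w => ay.1 (z, w)) ay.2 k x) ->
  2 * #|V|%:R <= B ^+ 2 -> (0 < K)%N -> K%:R <= B ^+ 4 ->
  \sum_(c : tree D (n + 5 * l) | [exists ay, Q ay &&
      misses (fun z w => ay.1 (z, w)) ay.2 x c]) tree_wt p c <=
  2 * (1 - p / 2) ^+ l + #|{: {ffun V * D -> V} * V}|%:R * (1 - del) ^+ K.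
Proof.
move=> B r n del Qok VB K0 KB.
have V1 : 1 <= #|V|%:R :> R by rewrite ler1n; apply/card_gt0P; exists x.
have B20 : 2 <= B ^+ 2 by lra.
have del0 : 0 < del by rewrite invr_gt0; lra.
have del1 : del < 1 by rewrite invf_lt1; lra.
set s : R := 1 - (2 * K%:R)^-1; set lam := (1 - del)^-1.
have K1 : 1 <= K%:R :> R by rewrite ler1n.
have s0 : 2^-1 <= s.
  have : (K%:R : R)^-1 <= 1 by rewrite invf_le1 ?ltr0n.
  by rewrite /s invfM; lra.
have s1 : s <= 1 by rewrite gerBl invr_ge0; lra.
have lam1 : 1 <= lam by rewrite invf_ge1; lra.
have lam0 : 0 < lam by lra.
(* Bernoulli: s^K >= 1 - K / (2K) = 1/2. *)
have sK : (s ^+ K)^-1 <= 2.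
  rewrite -[X in _ <= X]invrK lef_pV2 ?posrE ?exprn_gt0//; last by lra.
  have ber j : 1 - j%:R * (2 * K%:R)^-1 <= s ^+ j.
    elim: j => [|j IH]; first by rewrite mul0r subr0.
    rewrite exprSr (le_trans _ (ler_wpM2r _ IH))//; last by lra.
    set e := _^-1 in s s0 s1 IH *.
    have e0 : 0 <= e by rewrite invr_ge0; lra.
    rewrite -natr1 /s -subr_ge0 (_ : _ - _ = j%:R * (e * e)); last by ring.
    by rewrite !mulr_ge0.
  by apply: le_trans (ber K); rewrite invfM mulrCA divff ?mulr1; lra.
pose S (c : tree D (n + 5 * l)) := (s ^+ K)^-1 * s ^+ level_size n c.
pose L (ay : {ffun V * D -> V} * V) (c : tree D (n + 5 * l)) := (lam ^+ K)^-1 *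
  tree_prod (fun z w => ay.1 (z, w)) (miss_weight ay.2 n lam) x c.
have wt0 m (c : tree D m) : 0 <= tree_wt p c by rewrite tree_wt_ge0// p_le1 ltW.
have L0 ay c : 0 <= L ay c.
  by rewrite /L tree_prod_miss !mulr_ge0 ?invr_ge0 ?exprn_ge0// ltW.
have S0 c : 0 <= S c.
  by rewrite mulr_ge0 ?invr_ge0 ?exprn_ge0//; lra.
apply: (@le_trans _ _ (\sum_(c : tree D (n + 5 * l))
    tree_wt p c * (S c + \sum_(ay | Q ay) L ay c))).
  rewrite big_mkcond /=; apply: ler_sum => c _.
  case: existsP => [[ay /andP[Qay miss]]|_]; last first.
    by rewrite mulr_ge0// addr_ge0// sumr_ge0.
  rewrite -[X in X <= _]mulr1 ler_wpM2l//.
  case: (leqP (level_size n c) K) => cK.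
    rewrite -[1]addr0 lerD ?sumr_ge0// /S ler_pdivlMl ?exprn_gt0 ?mulr1//; last by lra.
    by rewrite ler_wiXn2l//; lra.
  rewrite -[1]add0r lerD// (bigD1 ay)//= -[1]addr0 lerD ?sumr_ge0//.
  rewrite /L tree_prod_miss miss mul1r ler_pdivlMl ?exprn_gt0 ?mulr1//.
  by rewrite ler_weXn2l// ltnW.
under eq_bigr do rewrite mulrDr.
rewrite big_split lerD//=.
  under eq_bigr do rewrite mulrCA -(tree_prod_size (fun z _ => z) n s x).
  have s01 : 0 <= 1 - s <= 1 by apply/andP; split; lra.
  rewrite -mulr_sumr mean_prodE// mean_prod_size ler_pM//.
  - by rewrite invr_ge0 exprn_ge0//; lra.
  - by rewrite subr_ge0; case/andP: (iter_grow_itv (5 * l) s01).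
  apply: iter_grow => //.
  (* Here a0 = 1 - s = 1/(2K), and K <= B^4 = (1 + p/2)^(4l) is what the first phase of [iter_grow]
     requires. *)
  rewrite opprB addrC subrK mulnC exprM -/B invfM -mulrA -[X in X <= _]mulr1.
  by rewrite ler_wpM2l ?invr_ge0// ler_pdivlMl ?mulr1//; lra.
under eq_bigr do rewrite mulr_sumr.
rewrite exchange_big /= -sum1_card natr_sum mulr_suml.
apply: (@le_trans _ _ (\sum_(ay | Q ay) 1%:R * (1 - del) ^+ K)); last first.
  by rewrite big_mkcond ler_sum// => ay _; case: ifP; rewrite mul1r ?exprn_ge0//; lra.
apply: ler_sum => ay Qay; rewrite mul1r.
under eq_bigr do rewrite mulrCA.
rewrite -mulr_sumr mean_prodE//.
rewrite -[X in _ <= X]mulr1 /lam exprVn invrK ler_wpM2l ?exprn_ge0//; first by lra.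
have [sa wx] := Qok _ Qay.
apply: (mean_prod_miss sa (ltW lam0) _ wx) => z wz.
(* The condition lam (1 - h) <= 1 means h >= del, which is [hit_pr_ge] at distance r = k + 5l. *)
rewrite mulrC ler_pdivrMr; last by lra.
rewrite mul1r lerD2l lerN2 /del /B -exprM muln2 -addnn.
apply: (hit_pr_ge D_gt0 p_gt0 p_le1 sa _ wz).
by rewrite addnn -muln2 exprM.
Qed.

End UnionBound.

(** * Choice of the parameters *)

Section NumericChoice.
Variable R : realType.

Lemma bernoulli_ge (b : R) n : 0 <= b -> 1 + n%:R * b <= (1 + b) ^+ n.
Proof.
move=> b0; elim: n => [|n IH]; first by rewrite mul0r addr0.
rewrite exprS; apply: le_trans (ler_wpM2l _ IH); last by rewrite addr_ge0.
rewrite -natr1 -subr_ge0 (_ : _ - _ = n%:R * (b * b)); last by ring.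
by rewrite !mulr_ge0.
Qed.

(** For l = (m + 1) q, the right side is at least (q b)^(m+1) by Bernoulli, which exceeds C ((m + 1)
    q)^m as soon as q >= t. *)
Lemma poly_le_exp (b : R) (C m N : nat) : 0 < b ->
  exists2 l, (N <= l)%N & (C * l ^ m)%:R <= (1 + b) ^+ l.
Proof.
move=> b0; set t := (C * m.+1 ^ m)%:R / b ^+ m.+1.
set q := (maxn N (Num.truncn t).+1); exists (m.+1 * q)%N.
  by apply: (leq_trans (leq_maxl N (Num.truncn t).+1)); rewrite leq_pmull.
have tq : t <= q%:R.
  apply: le_trans (ltW (Num.Theory.truncnS_gt t)) _.
  by rewrite ler_nat leq_maxr.
apply: (@le_trans _ _ ((q%:R * b) ^+ m.+1)).
  rewrite expnMn mulnA natrM natrX mulrC exprMn [q%:R ^+ m.+1]exprSr -mulrA.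
  rewrite ler_wpM2l ?exprn_ge0//.
  by move: tq; rewrite /t ler_pdivrMr ?exprn_gt0// mulnC.
rewrite mulnC exprM lerXn2r ?nnegrE//.
- by rewrite mulr_ge0// ltW.
- by rewrite exprn_ge0// addr_ge0// ltW.
by apply: le_trans (bernoulli_ge q (ltW b0)); rewrite lerDr.
Qed.

(* The height n + 5l of the trees in [tree_union_bound]. *)
Definition horizon (D k l : nat) : nat :=
  ((k + 5 * l) + (k + 5 * l) * D * (l + l) + 5 * l)%N.

(** The horizon is quadratic in l, so v is at most of order l^(2 dim) and v^2 of order l^(4 dim).
    The term v (v D + 1) bounds the logarithm of v^(v D) v, the number of pairs of an action and a
    target. *)
Lemma horizon_bound D k l dim v : (0 < l)%N ->
  (v <= (horizon D k l).*2.+1 ^ dim)%N ->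
  (2 * (l + v * (v * D + 1)) <=
   2 * (D + 2) * (2 * (5 + (k + 5) * (1 + 2 * D)) + 1) ^ (dim * 2) *
     l ^ (dim * 4 + 1))%N.
Proof.
move=> l0 vle; set C := (2 * _ + 1)%N.
have hl : (horizon D k l <= (5 + (k + 5) * (1 + 2 * D)) * (l * l))%N.
  have rl : (k + 5 * l <= (k + 5) * l)%N by nia.
  have ll : (l <= l * l)%N by nia.
  rewrite /horizon; move: (k + 5 * l)%N rl => r rl.
  have : (r * D * (l + l) <= (k + 5) * l * D * (l + l))%N by rewrite !leq_mul.
  nia.
have {}vle : (v <= C ^ dim * l ^ (dim * 2))%N.
  apply: (leq_trans vle); rewrite [(dim * 2)%N]mulnC expnM -expnMn.
  case: dim {vle} => [|e]; first by rewrite !expn0.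
  rewrite leq_exp2r// -muln2 -mulnn {}/C.
  by move: (5 + _)%N hl => c hl; have : (0 < l * l)%N; [rewrite muln_gt0 l0 | nia].
have C0 : (0 < C)%N by rewrite /C addn1.
have vv : (v * v <= C ^ (dim * 2) * l ^ (dim * 4))%N.
  apply: (leq_trans (leq_mul vle vle)).
  by rewrite mulnACA -!expnD -mulnDr addnn -muln2.
have lD : (l <= C ^ (dim * 2) * l ^ (dim * 4 + 1))%N.
  by rewrite addn1 expnSr mulnA leq_pmull// muln_gt0 !expn_gt0 C0 l0.
have vD : (v * v <= C ^ (dim * 2) * l ^ (dim * 4 + 1))%N.
  by rewrite addn1 expnSr mulnA (leq_trans vv)// leq_pmulr.
have {vle}vD1 : (v <= v * v)%N by case: (v) => // v'; rewrite leq_pmulr.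
rewrite -!mulnA leq_mul2l /=.
move: (C ^ _ * _)%N lD vD => E lD vD.
have : (v * (v * D) <= E * D)%N by rewrite mulnA leq_mul.
by nia.
Qed.

(** l is so large that B dominates the polynomial of [horizon_bound]. Taking K just above B^3 keeps
    K <= B^4, while K del >= B/2 beats the logarithm of the number of pairs. *)
Lemma choose_parameters (p : R) (D k dim N : nat) : 0 < p -> p <= 1 ->
  exists l K : nat,
  let B := (1 + p / 2) ^+ l in
  let del := (2 * B ^+ 2)^-1 in
  [/\ (N < l)%N, (0 < K)%N, K%:R <= B ^+ 4 &
    forall v, (0 < v)%N -> (v <= (horizon D k l).*2.+1 ^ dim)%N ->
      2 * v%:R <= B ^+ 2 /\
      2 * (1 - p / 2) ^+ l + (v ^ (v * D) * v)%:R * (1 - del) ^+ K <=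
        2 * l%:R^-1].
Proof.
move=> p0 p1.
have b0 : 0 < p / 2 by rewrite divr_gt0.
have [l Nl Bl] := poly_le_exp
  (2 * (D + 2) * (2 * (5 + (k + 5) * (1 + 2 * D)) + 1) ^ (dim * 2))
  (dim * 4 + 1) N.+1 b0.
have l0 : (0 < l)%N by exact: leq_ltn_trans Nl.
pose B := (1 + p / 2) ^+ l; pose K := (Num.truncn (B ^+ 3)).+1.
have {}Bl v : (v <= (horizon D k l).*2.+1 ^ dim)%N ->
    2 * (l%:R + v%:R * (v%:R * D%:R + 1)) <= B.
  move=> /(horizon_bound l0); rewrite -(ler_nat R) => hb.
  by apply: le_trans (le_trans hb Bl); rewrite !(natrM, natrD).
have l1 : 1 <= l%:R :> R by rewrite ler1n.
have B2 : 2 * l%:R <= B.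
  apply: le_trans (Bl 0%N _) => //; first by lra.
have B3 : B ^+ 3 <= K%:R by apply/ltW/Num.Theory.truncnS_gt.
exists l, K => /=; rewrite -/B; split=> //.
- have B30 : (Num.truncn (B ^+ 3))%:R <= B ^+ 3.
    by rewrite Num.Theory.truncn_le exprn_ge0//; lra.
  rewrite /K -natr1; apply: (@le_trans _ _ (B ^+ 3 + 1)); first by rewrite lerD2r.
  have B31 : 1 <= B ^+ 3 by rewrite exprn_ege1//; lra.
  rewrite [B ^+ 4]exprS; move: (B ^+ 3) B31 => B3' B31.
  have : 2 * B3' <= B * B3' by rewrite ler_wpM2r//; lra.
  by lra.
move=> v v0 /Bl Bv; have v1 : 1 <= v%:R :> R by rewrite ler1n.
have D0 : 0 <= v%:R * (v%:R * D%:R) :> R by rewrite !mulr_ge0.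
split.
  have : 1 * B <= B ^+ 2 by rewrite expr2 ler_wpM2r//; lra.
  by move: Bv; rewrite mulrDr; lra.
have -> : 2 * l%:R^-1 = l%:R^-1 + l%:R^-1 :> R by ring.
apply: lerD.
  (* Since (1 - p/2)(1 + p/2) <= 1, (1 - p/2)^l <= 1/B <= 1/(2l). *)
  apply: (@le_trans _ _ (2 * B^-1)).
    rewrite ler_wpM2l// -[X in X <= _]mulr1 -[B^-1]mul1r ler_pdivlMr; last by lra.
    rewrite mulr1 -exprMn exprn_ile1//.
      by rewrite mulr_ge0//; lra.
    rewrite -subr_ge0 (_ : _ - _ = (p / 2) ^+ 2); last by ring.
    exact: sqr_ge0.
  rewrite ler_pdivrMr; last by lra.
  by rewrite ler_pdivlMl; lra.
set del := _^-1; have delB : del * B ^+ 3 = B / 2.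
  by rewrite /del; field; lra.
have del1 : 0 <= 1 - del.
  have ? : 1 <= B ^+ 2 by rewrite exprn_ege1//; lra.
  by rewrite subr_ge0 invf_le1; lra.
(* From v <= e^v and 1 - del <= e^(-del); the total exponent is at most -l, and e^(-l) <= 1/l. *)
apply: (@le_trans _ _ (expR (v%:R * (v%:R * D%:R + 1)) * expR (- del * K%:R))).
  apply: ler_pM => //; first by rewrite exprn_ge0.
    rewrite -expnSr natrX -natrM natr1 mulrC expRM_natl.
    rewrite lerXn2r ?nnegrE ?expR_ge0//.
    by apply: le_trans (expR_ge1Dx _); lra.
  rewrite mulrC expRM_natl lerXn2r ?nnegrE ?expR_ge0//.
  by apply: le_trans (expR_ge1Dx _).
rewrite -expRD; apply: (@le_trans _ _ (expR (- l%:R))).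
  rewrite ler_expR mulNr.
  have : del * B ^+ 3 <= del * K%:R.
    by rewrite ler_wpM2l// invr_ge0 mulr_ge0// exprn_ge0//; lra.
  by rewrite delB; lra.
rewrite expRN lef_pV2 ?posrE ?expR_gt0//; last by lra.
by apply: le_trans (expR_ge1Dx _); lra.
Qed.

End NumericChoice.

(** * The law of the binary subtrees of a branching random walk *)

Section TreeLaw.
Variables (R : realType) (dim : nat) (d : measure_display).
Variables (T : measurableType d) (P : probability T R) (mu : probability nat R).
Variables (xi : offspring_family T) (X : step_family dim T).
Hypothesis brw : branching_random_walk P mu xi X.

Definition letter : finType := ('I_dim * bool)%type.

(* All children but the first are discarded. *)
Fixpoint brw_tree (n : nat) (u : seq nat) (omega : T) : tree letter n :=
  if n is m.+1 then
    ((0 < xi u omega)%N,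
      ((X u 0 omega, brw_tree m (rcons u 0%N) omega),
       (X u 1 omega, brw_tree m (rcons u 1%N) omega)))
  else tt.

Definition branch_pr : R := fine (mu [set k | k != 0%N]).

Lemma branch_prE : mu [set k | k != 0%N] = branch_pr%:E.
Proof. by rewrite /branch_pr fineK// fin_num_measure. Qed.

Lemma branch_pr_le1 : branch_pr <= 1.
Proof. by rewrite -lee_fin -branch_prE probability_le1. Qed.

Fixpoint tree_indices (n : nat) (u : seq nat) :
    seq (seq nat + (seq nat * nat)) :=
  if n is m.+1 then
    [:: inl u, inr (u, 0%N), inr (u, 1%N) &
      tree_indices m (rcons u 0%N) ++ tree_indices m (rcons u 1%N)]
  else [::].

Lemma tree_indices_prefix n u i : i \in tree_indices n u ->
  seq.prefix u (match i with inl v => v | inr (v, _) => v end).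
Proof.
elim: n u => [//|n IH] u /=; rewrite !inE mem_cat.
case/or4P => [/eqP->|/eqP->|/eqP->|]; rewrite ?prefix_refl//.
by case/orP => /IH; apply: prefix_trans; rewrite prefix_rcons.
Qed.

(** The entry at position [size u] tells the two subtrees apart, and the length tells both from the
    root. *)
Lemma tree_indices_label n u k i : i \in tree_indices n (rcons u k) ->
  nth 0%N (match i with inl v => v | inr (v, _) => v end) (size u) = k /\
  (size u < size (match i with inl v => v | inr (v, _) => v end))%N.
Proof.
move=> /tree_indices_prefix/prefixP[t ->].
by rewrite cat_rcons nth_cat ltnn subnn size_cat /= addnS ltnS leq_addr.
Qed.

Lemma tree_indices_uniq n u : uniq (tree_indices n u).
Proof.
elim: n u => [//|n IH] u /=.
have short i k :
    (size (match i with inl v => v | inr (v, _) => v end) <= size u)%N ->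
    i \notin tree_indices n (rcons u k).
  by move=> iu; apply/negP => /tree_indices_label[_]; rewrite ltnNge iu.
rewrite !inE !mem_cat !negb_or !short//= cat_uniq !IH !andbT /=.
apply/andP; split; first by apply/eqP; case.
apply/hasPn => i /tree_indices_label[i1 _].
by apply/negP => /tree_indices_label[i0 _]; rewrite i0 in i1.
Qed.

Lemma brw_sigma_measurable i A : brw_sigma xi X i A -> measurable A.
Proof.
case: brw => mxi mX _ _ _.
by case: i => [u|[u k]] [B _ <-]; rewrite setTI.
Qed.

(** The event is cut into one event per variable that the tree reads, so that a single use of the
    independence of the whole family yields its probability. *)
Lemma brw_tree_cylinder n u (c : tree letter n) :
  exists A : seq nat + (seq nat * nat) -> set T,
  [/\ forall i, i \in tree_indices n u -> brw_sigma xi X i (A i),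
      forall omega, brw_tree n u omega = c <->
        (forall i, i \in tree_indices n u -> A i omega) &
      (\prod_(i <- tree_indices n u) P (A i) = (tree_wt branch_pr c)%:E)%E].
Proof.
case: brw => _ _ xi_law X_law _.
elim: n u c => [|n IH] u c.
  by exists (fun=> setT); split=> //; [case: c | rewrite big_nil].
case: c => [e [[w0 c0] [w1 c1]]].
have [A0 [F0 E0 P0]] := IH (rcons u 0%N) c0.
have [A1 [F1 E1 P1]] := IH (rcons u 1%N) c1.
pose Axi := [set omega | (0 < xi u omega)%N = e].
pose AX k w := [set omega | X u k omega = w].
pose A i := if i == inl u then Axi else if i == inr (u, 0%N) then AX 0%N w0
  else if i == inr (u, 1%N) then AX 1%N w1
  else if i \in tree_indices n (rcons u 0%N) then A0 i else A1 i.
have := tree_indices_uniq n.+1 u.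
rewrite /= !inE !mem_cat cat_uniq !negb_or.
move=> /and5P[/and4P[_ _ xi0 xi1] /and3P[_ X00 X01] /andP[X10 X11] _ /andP[dis _]].
have AA0 i : i \in tree_indices n (rcons u 0%N) -> A i = A0 i.
  move=> i0; rewrite /A i0.
  case: eqP => [E|_]; first by rewrite E (negbTE xi0) in i0.
  case: eqP => [E|_]; first by rewrite E (negbTE X00) in i0.
  by case: eqP => [E|//]; rewrite E (negbTE X10) in i0.
have AA1 i : i \in tree_indices n (rcons u 1%N) -> A i = A1 i.
  move=> i1; rewrite /A; have /negbTE -> := hasPn dis _ i1.
  case: eqP => [E|_]; first by rewrite E (negbTE xi1) in i1.
  case: eqP => [E|_]; first by rewrite E (negbTE X01) in i1.
  by case: eqP => [E|//]; rewrite E (negbTE X11) in i1.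
have Axi_E : A (inl u) = Axi by rewrite /A eqxx.
have AX0 : A (inr (u, 0%N)) = AX 0%N w0 by rewrite /A /= eqxx.
have AX1 : A (inr (u, 1%N)) = AX 1%N w1.
  by rewrite /A /= (_ : _ == _ = false) ?eqxx//; apply/eqP; case.
exists A; split.
- move=> i; rewrite !inE mem_cat; case/or4P => [/eqP->|/eqP->|/eqP->|].
  + rewrite Axi_E; exists [set k | (0 < k)%N = e] => //; by rewrite setTI.
  + by rewrite AX0; exists [set w0] => //; rewrite setTI.
  + by rewrite AX1; exists [set w1] => //; rewrite setTI.
  by case/orP => ii; [rewrite AA0//; exact: F0 | rewrite AA1//; exact: F1].
- move=> omega /=; split.
    case=> Ee Ew0 Et0 Ew1 Et1 i; rewrite !inE mem_cat.
    case/or4P => [/eqP->|/eqP->|/eqP->|]; rewrite ?Axi_E ?AX0 ?AX1//.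
    case/orP => ii.
      by rewrite AA0//; apply: (E0 omega).1.
    by rewrite AA1//; apply: (E1 omega).1.
  move=> H.
  have := H (inl u); rewrite Axi_E !inE eqxx => /(_ isT) Ee.
  have := H (inr (u, 0%N)); rewrite AX0 !inE eqxx orbT => /(_ isT) Ew0.
  have := H (inr (u, 1%N)); rewrite AX1 !inE eqxx !orbT => /(_ isT) Ew1.
  have -> : brw_tree n (rcons u 0%N) omega = c0.
    apply: (E0 omega).2 => i i0; rewrite -AA0//; apply: H.
    by rewrite !inE mem_cat i0 !orbT.
  have -> : brw_tree n (rcons u 1%N) omega = c1.
    apply: (E1 omega).2 => i i1; rewrite -AA1//; apply: H.
    by rewrite !inE mem_cat i1 !orbT.
  by rewrite Ee Ew0 Ew1.
rewrite /= !big_cons big_cat /= Axi_E AX0 AX1.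
rewrite (eq_big_seq _ (fun i i0 => congr1 P (AA0 i i0))) P0.
rewrite (eq_big_seq _ (fun i i1 => congr1 P (AA1 i i1))) P1.
have -> : P Axi = (if e then branch_pr else 1 - branch_pr)%:E.
  rewrite (xi_law u [set k | (0 < k)%N = e]).
  case: e {Axi A AA0 AA1 Axi_E AX0 AX1}.
    by rewrite -branch_prE; congr (mu _); apply/seteqP; split=> -[].
  rewrite EFinB -branch_prE -probability_setC//.
  by congr (mu _); apply/seteqP; split=> -[|k]//= /(_ erefl).
rewrite (X_law u 0%N w0) (X_law u 1%N w1).
have cardE : #|{: letter}| = (2 * dim)%N.
  by rewrite card_prod card_ord card_bool mulnC.
by rewrite cardE -!EFinM; congr (_%:E); ring.
Qed.

Lemma brw_tree_pr_le n u (S : pred (tree letter n)) :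
  measurable [set omega | S (brw_tree n u omega)] /\
  (P [set omega | S (brw_tree n u omega)] <=
    (\sum_(c | S c) tree_wt branch_pr c)%:E)%E.
Proof.
have cyl (c : tree letter n) : measurable [set omega | brw_tree n u omega = c] /\
    P [set omega | brw_tree n u omega = c] = (tree_wt branch_pr c)%:E.
  have [A [FA EA PA]] := brw_tree_cylinder u c.
  have -> : [set omega | brw_tree n u omega = c] =
      \bigcap_(i in [set` tree_indices n u]) A i.
    by apply/seteqP; split => omega /= /EA.
  split; last by rewrite (brw_independent brw)// tree_indices_uniq.
  apply: fin_bigcap_measurable; first exact: finite_seq.
  by move=> i /= /FA; exact: brw_sigma_measurable.
have -> : [set omega | S (brw_tree n u omega)] =
    \big[setU/set0]_(c | S c) [set omega | brw_tree n u omega = c].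
  rewrite -bigcup_seq_cond; apply/seteqP; split=> omega /=.
    by move=> Sc; exists (brw_tree n u omega) => //=; rewrite mem_index_enum.
  by case=> c /= /andP[_ Sc] ->.
rewrite -sumEFin.
apply: (big_rec2 (fun A s => measurable A /\ (P A <= s)%E)).
  by rewrite measure0; split.
move=> c r A Sc [mA Ar]; have [mc Pc] := cyl c.
split; first exact: measurableU.
apply: (le_trans (measureU2 _ mc mA)).
by apply: leeD => //; rewrite -Pc.
Qed.

End TreeLaw.

(** * Walks on subgraphs of the lattice *)

Section Walks.
Variable dim : nat.
Implicit Types (G : rel (site dim)) (x y : site dim) (w : direction dim).

Definition step G x w : site dim :=
  let x' := x + dir_vec w in if G x x' then x' else x.

Definition walk G x (s : seq (direction dim)) : site dim := foldl (step G) x s.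

(** A sum of integer squares equal to 1 has one term 1 and all others 0. *)
Lemma edge_dir x y : lattice_edge x y -> exists w, y = x + dir_vec w.
Proof.
rewrite /lattice_edge => /eqP sum1.
have [i xyi] : exists i, x 0 i != y 0 i.
  apply/existsP; apply: contraT; rewrite negb_exists => /forallP eqxy.
  move: sum1; rewrite big1 // => i _.
  by have := eqxy i; rewrite negbK => /eqP ->; rewrite subrr expr0n.
pose t i := x 0 i - y 0 i.
have ti : t i != 0 by rewrite subr_eq0.
have ti2 : 1 <= t i ^+ 2 by rewrite -gtz0_ge1 exprn_even_gt0.
have rest0 : forall j, j != i -> t j = 0.
  have S0 : \sum_(j < dim | j != i) t j ^+ 2 = 0.
    move: sum1; rewrite (bigD1 i)//= -/(t i).
    rewrite -[X in _ + X]/(\sum_(j < dim | j != i) t j ^+ 2).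
    have : 0 <= \sum_(j < dim | j != i) t j ^+ 2.
      by apply: sumr_ge0 => j _; exact: sqr_ge0.
    by move: ti2; move: (\sum_(j < dim | j != i) _) (t i ^+ 2) => a b; lia.
  move=> j ji; have /psumr_eq0P : forall j, j != i -> 0 <= t j ^+ 2.
    by move=> k _; exact: sqr_ge0.
  by move=> /(_ S0 j ji) /eqP; rewrite sqrf_eq0 => /eqP.
have {}ti : t i = 1 \/ t i = -1.
  move: sum1; rewrite (bigD1 i)//= -/(t i) big1 ?addr0; last first.
    by move=> j ji; rewrite -/(t j) rest0.
  by move=> /eqP; rewrite sqrf_eq1 => /orP[] /eqP ->; [left|right].
(* t is x - y, so the step from x to y is positive when t i < 0. *)
exists (i, t i < 0); apply/rowP => j; rewrite /dir_vec /=.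
have -> : y 0 j = x 0 j - t j by rewrite /t opprB addrC subrK.
case: (eqVneq j i) => [->|ji]; last first.
  rewrite rest0// subr0 !mxE; case: ifP => _; rewrite !mxE (negbTE ji) andbF.
    by rewrite addr0.
  by rewrite oppr0 addr0.
by case: ti => ->; rewrite ?ltr10 ?ltrN10 !mxE !eqxx ?opprK.
Qed.

Lemma step_connected G x w : connected_in G x (step G x w).
Proof.
rewrite /step; case: ifP => Gx; last by exists [::].
by exists [:: x + dir_vec w]; rewrite //= Gx.
Qed.

Lemma connected_trans G x y z :
  connected_in G x y -> connected_in G y z -> connected_in G x z.
Proof.
move=> [p Gp <-] [q Gq <-]; exists (p ++ q); last by rewrite last_cat.
by rewrite cat_path Gp.
Qed.

Lemma connected_sym G x y : symmetric G ->
  connected_in G x y -> connected_in G y x.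
Proof.
move=> Gs [p]; elim: p x => [|z p IH] x /=; first by move=> _ ->; exists [::].
move=> /andP[xz zp] py; apply: connected_trans (IH _ zp py) _.
by exists [:: x]; rewrite //= Gs xz.
Qed.

Lemma walk_connected G x s : connected_in G x (walk G x s).
Proof.
elim: s x => [|w s IH] x; first by exists [::].
exact: connected_trans (step_connected G x w) (IH _).
Qed.

Definition translate G x : rel (site dim) := fun y z => G (x + y) (x + z).

Lemma translate_spanning G x :
  spanning_subgraph G -> spanning_subgraph (translate G x).
Proof.
move=> [Gs Ge]; split=> [y z|y z /Ge]; first exact: Gs.
rewrite /lattice_edge => /eqP <-; apply/eqP/eq_bigr => i _; rewrite !mxE.
by congr (_ ^+ 2); ring.
Qed.

Lemma walk_translate G x y s :
  x + walk (translate G x) y s = walk G (x + y) s.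
Proof.
elim: s y => [//|w s IH] y; rewrite /= IH; congr (walk _ _ _).
by rewrite /step /translate addrA; case: ifP => // _; rewrite addrA.
Qed.

Lemma path_translate G x y p :
  path (translate G x) y [seq z - x | z <- p] = path G (x + y) p.
Proof.
elim: p y => [//|z p IH] y; rewrite /= IH /translate.
by rewrite addrCA subrr addr0.
Qed.

Definition in_box (r : nat) x : bool := [forall i, (absz (x 0%R i) <= r)%N].

Definition box (r : nat) : seq (site dim) :=
  undup [seq \row_i ((f i : nat)%:Z - r%:Z) |
    f : {ffun 'I_dim -> 'I_(r.*2.+1)} <- enum {: {ffun 'I_dim -> 'I_(r.*2.+1)}}].

Lemma mem_box r x : (x \in box r) = in_box r x.
Proof.
rewrite mem_undup; apply/idP/forallP => [/mapP[f _ ->] i|xr].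
  have fi : (f i < (r + r).+1)%N by rewrite addnn ltn_ord.
  by rewrite mxE; move: (nat_of_ord (f i)) fi => a; lia.
apply/mapP; exists [ffun i => inord (absz (x 0 i + r%:Z))].
  by rewrite mem_enum.
apply/rowP => i; rewrite mxE ffunE; move: (x 0 i : int) (xr i) => a ar.
by rewrite inordK -?addnn; lia.
Qed.

Lemma size_box r : (size (box r) <= r.*2.+1 ^ dim)%N.
Proof.
apply: leq_trans (size_undup _) _.
by rewrite size_map -cardE card_ffun !card_ord.
Qed.

Lemma in_box_step G r x w : in_box r x -> in_box r.+1 (step G x w).
Proof.
move=> /forallP xr; apply/forallP => i; have {xr} := xr i.
rewrite /step; case: ifP => _; last by move=> /leqW.
rewrite /dir_vec; case: (w.2); rewrite !mxE; case: (_ && _) => /=; lia.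
Qed.

Lemma step_dir_in_box G r x w : in_box r x -> G x (x + dir_vec w) ->
  in_box r.+1 (x + dir_vec w).
Proof. by move=> /(in_box_step G w); rewrite /step => + Gx; rewrite Gx. Qed.

Lemma last_in_box G k x p : subrel G (@lattice_edge dim) ->
  in_box k x -> path G x p -> in_box (k + size p) (last x p).
Proof.
move=> Ge; elim: p k x => [|z p IH] k x xk /=; first by rewrite addn0.
move=> /andP[xz zp]; rewrite -addSnnS; apply: IH zp.
have [w zE] := edge_dir (Ge _ _ xz).
by rewrite zE; apply: (@step_dir_in_box G _ _ _ xk); rewrite -zE.
Qed.

(** * The walk confined to a box *)

Section BoxAction.
Variables (G : rel (site dim)) (r : nat).

(** A letter leading out of the box leaves the walk at x, through the default value of [insubd];
    this keeps the action symmetric. *)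
Definition box_act (x : seq_sub (box r)) (w : letter dim) : seq_sub (box r) :=
  let x' := val x + dir_vec w in if G (val x) x' then insubd x x' else x.

Lemma val_box_act k (x : seq_sub (box r)) w : in_box k (val x) -> (k < r)%N ->
  val (box_act x w) = step G (val x) w.
Proof.
move=> xk kr; rewrite /box_act /step; case: ifP => // Gx.
rewrite insubdK// -topredE /= mem_box; have /forallP H := step_dir_in_box xk Gx.
by apply/forallP => i; apply: leq_trans (H i) kr.
Qed.

(** For distinct x and z, reversing letters injects those leading from x to z into those leading
    from z to x, and conversely. *)
Lemma box_act_symmetric : symmetric G -> symmetric_act box_act.
Proof.
move=> Gs; pose opp (w : letter dim) : letter dim := (w.1, ~~ w.2).
have oppK : involutive opp by case=> i b; rewrite /opp /= negbK.
have dir_opp (w : letter dim) : dir_vec (opp w) = - dir_vec w.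
  by rewrite /dir_vec /=; case: (w.2); rewrite ?opprK.
have le (x z : seq_sub (box r)) : x != z ->
    (#|[pred w | box_act x w == z]| <= #|[pred w | box_act z w == x]|)%N.
  move=> xz; rewrite -(fintype.card_image (inv_inj oppK)); apply: subset_leq_card.
  apply/fintype.subsetP => _ /fintype.imageP[w + ->]; rewrite !inE /box_act.
  case: ifP => [Gx /eqP zE|_ /eqP E]; last by rewrite E eqxx in xz.
  have zV : val z = val x + dir_vec w.
    move: zE; rewrite /insubd; case: insubP => [u _ <- <- //|_ /= E].
    by rewrite E eqxx in xz.
  by rewrite zV dir_opp addrK Gs Gx valKd.
apply/forallP => x; apply/forallP => z; case: (eqVneq x z) => [->//|xz].
by rewrite eqn_leq !le // eq_sym.
Qed.

Lemma box_act_reach (p : seq (site dim)) (x y : seq_sub (box r)) k :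
  subrel G (@lattice_edge dim) ->
  in_box k (val x) -> (k + size p <= r)%N -> path G (val x) p ->
  last (val x) p = val y -> reach_within box_act y (size p) x.
Proof.
move=> Ge; elim: p k x => [|z p IH] k x xk kr /=.
  by move=> _ /val_inj ->; rewrite eqxx.
move=> /andP[xz zp] lasty; apply/orP; right; apply/existsP.
have [w zE] := edge_dir (Ge _ _ xz); exists w.
have kr' : (k < r)%N by apply: leq_trans kr; rewrite /= addnS ltnS leq_addr.
have actE : val (box_act x w) = z by rewrite (val_box_act w xk kr') /step -zE xz.
apply: (IH k.+1); rewrite ?actE//; last by rewrite addSnnS.
by rewrite zE; apply: (@step_dir_in_box G _ _ _ xk); rewrite -zE.
Qed.

End BoxAction.
End Walks.

(** * Descendants of a particle *)

Section Descendants.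
Variables (dim : nat) (T : Type) (xi : offspring_family T).
Variables (X : step_family dim T) (omega : T).

Fixpoint descends (u b : seq nat) : bool :=
  if b is k :: b' then (k <= xi u omega)%N && descends (rcons u k) b' else true.

Fixpoint letters (u b : seq nat) : seq (direction dim) :=
  if b is k :: b' then X u k omega :: letters (rcons u k) b' else [::].

Lemma descends_cat u b b' :
  descends u (b ++ b') = descends u b && descends (u ++ b) b'.
Proof.
elim: b u => [|k b IH] u /=; first by rewrite cats0.
by rewrite IH cat_rcons andbA.
Qed.

Lemma letters_cat u b b' :
  letters u (b ++ b') = letters u b ++ letters (u ++ b) b'.
Proof.
elim: b u => [|k b IH] u /=; first by rewrite cats0.
by rewrite IH cat_rcons.
Qed.

(** The walk starts at 0 wherever u is: as hitting is proved for all G at once, other positions are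
    covered by [translate]. *)
Definition hits (u : seq nat) (G : rel (site dim)) (y : site dim) : Prop :=
  exists2 b, descends u b & walk G 0 (letters u b) = y.

End Descendants.

(** The invariant k + n <= r keeps the remaining steps inside the box, where [box_act] is the true
    walk on G. *)
Lemma misses_hit dim d (T : measurableType d) (xi : offspring_family T)
    (X : step_family dim T) omega (G : rel (site dim)) r n k u
    (x y : seq_sub (box dim r)) :
  in_box k (val x) -> (k + n <= r)%N ->
  ~~ misses (box_act G (r := r)) y x (brw_tree xi X n u omega) ->
  exists2 b, descends xi omega u b & walk G (val x) (letters X omega u b) = val y.
Proof.
elim: n k u x => [|n IH] k u x xk kr /=.
  by rewrite negbK => /eqP ->; exists [::].
case: eqVneq => [-> _|_ /=]; first by exists [::].
have kr' : (k < r)%N by lia.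
have child j : (j <= xi u omega)%N ->
    ~~ misses (box_act G (r := r)) y (box_act G x (X u j omega))
      (brw_tree xi X n (rcons u j) omega) ->
    exists2 b, descends xi omega u b &
      walk G (val x) (letters X omega u b) = val y.
  move=> jx /(IH k.+1); rewrite (val_box_act G (X u j omega) xk kr').
  move=> []; [exact: in_box_step | by rewrite addSnnS |] => b db wb.
  by exists (j :: b); rewrite //= jx.
rewrite negb_and negb_imply => /orP[m|/andP[x0 m]]; exact: child m.
Qed.

(** * Almost sure hitting and the recurrent branch *)

Section AlmostSureHitting.
Variables (R : realType) (dim : nat) (d : measure_display).
Variables (T : measurableType d) (P : probability T R) (mu : probability nat R).
Variables (xi : offspring_family T) (X : step_family dim T).
Hypotheses (dim_gt0 : (0 < dim)%N) (mu_nontrivial : nontrivial_offspring mu).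
Hypothesis brw : branching_random_walk P mu xi X.

Definition hits_at_distance (u : seq nat) (k : nat) (omega : T) : Prop :=
  forall G, spanning_subgraph G -> forall p, path G 0 p -> size p = k ->
    hits xi X omega u G (last 0 p).

Lemma miss_event_small u k N : exists2 E : set T,
  measurable E /\ (P E <= (2 * N.+1%:R^-1)%:E)%E &
  ~` [set omega | hits_at_distance u k omega] `<=` E.
Proof.
have D0 : (0 < #|{: letter dim}|)%N.
  by rewrite card_prod card_ord card_bool muln_gt0 dim_gt0.
have p0 : 0 < branch_pr mu by rewrite -lte_fin -branch_prE.
have p1 := branch_pr_le1 mu.
have [l [K [lN K0 KB small]]] :=
  choose_parameters #|{: letter dim}| k dim N p0 p1.
set M := horizon #|{: letter dim}| k l in small *.
pose V : finType := seq_sub (box dim M).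
have cardV : (#|V| <= M.*2.+1 ^ dim)%N.
  by rewrite card_seq_sub ?undup_uniq// size_box.
have x0P : (0 : site dim) \in box dim M.
  by rewrite mem_box; apply/forallP => i; rewrite mxE.
pose x0 : V := SeqSub x0P.
have V0 : (0 < #|V|)%N by apply/card_gt0P; exists x0.
have [VB {}small] := small _ V0 cardV.
pose Q (ay : {ffun V * letter dim -> V} * V) :=
  symmetric_act (fun z w => ay.1 (z, w)) &&
  reach_within (fun z w => ay.1 (z, w)) ay.2 k x0.
pose S (c : tree (letter dim) M) := [exists ay, Q ay &&
  misses (fun z w => ay.1 (z, w)) ay.2 x0 c].
have [mE PE] := brw_tree_pr_le brw u S.
exists [set omega | S (brw_tree xi X M u omega)].
  split=> //; apply: (le_trans PE); rewrite lee_fin.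
  apply: (@le_trans _ _ (2 * l%:R^-1)); last first.
    by rewrite ler_wpM2l// lef_pV2 ?posrE ?ltr0n// ?ler_nat// (leq_ltn_trans _ lN).
  apply: le_trans small.
  have cardQ : #|{: {ffun V * letter dim -> V} * V}| =
      (#|V| ^ (#|V| * #|{: letter dim}|) * #|V|)%N.
    by rewrite card_prod card_ffun (card_prod V (letter dim)).
  rewrite -cardQ; apply: (tree_union_bound D0 p0 p1 _ VB K0 KB).
  by move=> ay /andP[].
move=> omega /= nhit; apply: contrapT => /negP nS; apply: nhit => G [Gs Ge] p Gp pk.
have kM : (k <= M)%N by rewrite /M /horizon; lia.
have in0 : in_box 0 (val x0) by apply/forallP => i; rewrite mxE.
have yP : last 0 p \in box dim M.
  rewrite mem_box; apply/forallP => i.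
  have /forallP/(_ i)/leq_trans := last_in_box Ge in0 Gp; apply.
  by rewrite add0n pk.
have reach : reach_within (box_act G (r := M)) (SeqSub yP) k x0.
  by rewrite -pk; apply: (box_act_reach Ge in0) => //; rewrite pk.
(* The walk on G in the box becomes one of the actions counted in the union bound. *)
pose a : {ffun V * letter dim -> V} := [ffun xw => box_act G xw.1 xw.2].
have aE : (fun z w => a (z, w)) = box_act G (r := M).
  by apply/funext => z; apply/funext => w; rewrite ffunE.
have nmiss : ~~ misses (box_act G (r := M)) (SeqSub yP) x0 (brw_tree xi X M u omega).
  apply: contra nS => miss; apply/existsP; exists (a, SeqSub yP).
  by rewrite /Q /= aE miss box_act_symmetric// reach.
have [b ub wb] := misses_hit in0 (leqnn M) nmiss.
by exists b.
Qed.

Lemma ae_hits :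
  {ae P, forall omega, forall u G y, spanning_subgraph G ->
    connected_in G 0 y -> hits xi X omega u G y}.
Proof.
have neg u k : P.-negligible (~` [set omega | hits_at_distance u k omega]).
  have /choice[E EP] : forall N, exists E : set T,
      [/\ measurable E, (P E <= (2 * N.+1%:R^-1)%:E)%E &
        ~` [set omega | hits_at_distance u k omega] `<=` E].
    by move=> N; have [E [mE PE] sE] := miss_event_small u k N; exists E.
  exists (\bigcap_N E N); split.
  - by apply: bigcapT_measurable => N; have [] := EP N.
  - apply/eqP; rewrite eq_le measure_ge0 andbT.
    apply/lee_addgt0Pr => e e0; rewrite add0e.
    pose N := Num.truncn (2 / e); have [mE PE _] := EP N.
    apply: (@le_trans _ _ (P (E N))).
      apply: le_measure; rewrite ?inE//.
        by apply: bigcapT_measurable => N'; have [] := EP N'.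
      by apply: bigcap_inf.
    apply: (le_trans PE); rewrite lee_fin ler_pdivrMr ?ltr0n// -ler_pdivrMl// mulrC.
    exact/ltW/Num.Theory.truncnS_gt.
  - by move=> omega nh N _; have [_ _] := EP N; apply.
(* Pairs (u, k) are enumerated by [pickle]; numbers that encode no pair impose no condition. *)
pose good i := [set omega | if @unpickle (seq nat * nat)%type i is Some uk
  then hits_at_distance uk.1 uk.2 omega else True].
apply: (@negligibleS _ _ _ _ (\bigcup_i ~` good i)); last first.
  apply: negligible_bigcup => i; rewrite /good.
  case: unpickle => [[u k]|]; first exact: neg.
  by rewrite setCT; exact: negligible_set0.
move=> omega /= bad; apply: contrapT => nbad; apply: bad => u G y sG [p Gp <-].
apply: contrapT => nh; apply: nbad; exists (pickle (u, size p)) => //=.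
by rewrite /good /= pickleK => /(_ G sG p Gp erefl).
Qed.

End AlmostSureHitting.

(** * Concatenation into a recurrent branch *)

Section BuildBranch.
Variables (dim : nat) (T : Type) (xi : offspring_family T).
Variables (X : step_family dim T) (omega : T).

Lemma descends_take b n : descends xi omega [::] b -> (n < size b)%N ->
  (nth 0%N b n <= xi (take n b) omega)%N.
Proof.
move=> db nb; move: db; rewrite -{1}(cat_take_drop n b) descends_cat.
by rewrite (drop_nth 0%N nb) => /andP[_ /= /andP[]].
Qed.

Lemma induced_walkE G j n :
  induced_walk G (branch_word X omega j) n =
  walk G 0 (letters X omega [::] (label_at j n)).
Proof.
elim: n => [//|n IH]; rewrite [LHS]/= IH /label_at mkseqS -cats1 letters_cat.
by rewrite /walk foldl_cat.
Qed.

Lemma infinite_unbounded (A : set nat) :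
  (forall n, exists2 m, A m & (n <= m)%N) -> infinite_set A.
Proof.
move=> unb /finite_seqP[s sE].
have [m] := unb (\max_(i <- s) i).+1; rewrite sE /= => ms.
by apply/negP; rewrite -ltnNge ltnS leq_bigmax_seq.
Qed.

Lemma recurrent_branch (G : rel (site dim)) : spanning_subgraph G ->
  (forall u G y, spanning_subgraph G -> connected_in G 0 y ->
     hits xi X omega u G y) ->
  exists2 j, branches xi omega j &
    recurrent G (induced_walk G (branch_word X omega j)).
Proof.
move=> sG hit; have [Gs _] := sG.
pose pos b := walk G 0 (letters X omega [::] b).
have ext (uy : seq nat * site dim) : exists b,
    descends xi omega [::] uy.1 -> connected_in G 0 uy.2 ->
    [/\ (0 < size b)%N, descends xi omega [::] (uy.1 ++ b) & pos (uy.1 ++ b) = uy.2].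
  case: uy => u y /=; case: (pselect (connected_in G 0 y)) => [cy|]; last first.
    by exists [::].
  (* The particle itself makes one step first, so that the extension is nonempty even if it already
     sits at y. *)
  set x := pos (rcons u 0%N).
  have [p Gp py] : connected_in G x y.
    by apply: connected_trans cy; apply: connected_sym => //; exact: walk_connected.
  have cy' : connected_in (translate G x) 0 (y - x).
    exists [seq z - x | z <- p]; first by rewrite path_translate addr0.
    by rewrite -[X in last X](subrr x) (last_map (fun z => z - x)) py.
  have [b db wb] := hit (rcons u 0%N) _ _ (translate_spanning x sG) cy'.
  exists (0%N :: b) => du _; split=> //.
    by rewrite -cat_rcons descends_cat -cats1 descends_cat du /= cats1.
  rewrite -cat_rcons /pos letters_cat /walk foldl_cat -/(walk _ _ _) -/(pos _) -/x.
  by rewrite -/(walk G x _) -[x in walk _ x _]addr0 -walk_translate wb addrC subrK.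
have [f fP] := choice ext.
(* The targets run through all pairs (m, y), so each y of the component recurs infinitely often; the
   default 0 lies in the component. *)
pose target i : site dim :=
  if @unpickle (nat * site dim)%type i is Some my then
    if `[< connected_in G 0 my.2 >] then my.2 else 0 else 0.
have targetP i : connected_in G 0 (target i).
  rewrite /target; case: unpickle => [[m y]|] /=; last by exists [::].
  by case: asboolP => // _; exists [::].
pose U := fix U i := if i is i'.+1 then U i' ++ f (U i', target i') else [::].
have dU i : descends xi omega [::] (U i).
  elim: i => [//|i IH]; by have [] := fP (U i, target i) IH (targetP i).
have fU i := fP (U i, target i) (dU i) (targetP i).
have sizeU i : (i <= size (U i))%N.
  elim: i => [//|i IH]; rewrite /= size_cat.
  by have [f0 _ _] := fU i; rewrite -addn1 leq_add.
have prefU i k : take (size (U i)) (U (i + k)%N) = U i.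
  elim: k => [|k IH]; first by rewrite addn0 take_size.
  rewrite addnS /= takel_cat// -[in X in (X <= _)%N]IH.
  by rewrite size_take_min geq_minr.
have nthU i i' n : (n < size (U i))%N -> (n < size (U i'))%N ->
    nth 0%N (U i) n = nth 0%N (U i') n.
  wlog ii' : i i' / (i <= i')%N.
    by move=> W; case/orP: (leq_total i i') => H ni ni'; [apply: W|apply/esym/W].
  by move=> ni _; rewrite -(prefU i (i' - i)%N) subnKC// nth_take.
(* The limit of the labels U i, each a prefix of the next; [U n.+1] has length at least n + 1, so
   entry n is defined. *)
pose j n := nth 0%N (U n.+1) n.
have jU i n : (n <= size (U i))%N -> label_at j n = take n (U i).
  move=> ni; apply: (@eq_from_nth _ 0%N).
    by rewrite size_mkseq size_take_min (minn_idPl ni).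
  rewrite size_mkseq => m mn; rewrite nth_mkseq// nth_take//.
  by apply: nthU; [exact: sizeU | exact: leq_trans ni].
exists j.
  move=> n; rewrite (jU n.+1 n (ltnW (sizeU n.+1))).
  exact: descends_take (dU n.+1) (sizeU n.+1).
move=> y cy; refine (infinite_unbounded _) => n.
pose code m := @pickle (nat * site dim)%type (m, y).
(* Pigeonhole: n + 1 distinct codes cannot all lie below n. *)
have [m mn] : exists m, (n <= code m)%N.
  apply: contrapT => /forallNP small.
  have lt m : (code m < n)%N by rewrite ltnNge; apply/negP/small.
  have inj : injective (fun m : 'I_n.+1 => Ordinal (lt m)).
    by move=> a b [] /(pcan_inj pickleK)[] /val_inj.
  by have := leq_card _ inj; rewrite !card_ord ltnn.
exists (size (U (code m).+1)); last first.
  by apply: leq_trans mn _; apply: leq_trans (sizeU _); exact: leqnSn.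
have [_ _ posE] := fU (code m).
change (induced_walk G (branch_word X omega j) (size (U (code m).+1)) = y).
rewrite induced_walkE (jU _ _ (leqnn _)) take_size; apply: etrans posE _.
by rewrite /target pickleK /= asboolT.
Qed.

End BuildBranch.

Theorem theorem1p3 (R : realType) (dim : nat) (dim_gt0 : (0 < dim)%N)
    (d : measure_display) (T : measurableType d) (P : probability T R)
    (mu : probability nat R) (mu_nontrivial : nontrivial_offspring mu)
    (xi : offspring_family T) (X : step_family dim T)
    (brw : branching_random_walk P mu xi X) :
  {ae P, forall omega : T,
    forall G : rel (site dim), spanning_subgraph G ->
      exists2 j : nat -> nat, branches xi omega j &
        recurrent G (induced_walk G (branch_word X omega j))}.
Proof.
have := ae_hits dim_gt0 mu_nontrivial brw; apply: filterS => omega hit G sG.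
exact: recurrent_branch.
Qed.
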